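(* For each point $P_i\in C_0\cap\bigcup_{j\ge1}C_j$, $$\{f_1,f_2,f_3\}_{C_0,P_i}=\exp\left((2\pi i)^{-2}\,\mathrm{Log}\{f_1,f_2,f_3\}^{\gamma_i}_{C_0,P_i}\right)g_1(Q)^{D_1}g_2(Q)^{D_2}g_3(Q)^{D_3},$$ where $Q$ is the base point.
   Context: Let $X$ be a smooth complex projective surface and let $f_1,f_2,f_3$ be non-zero rational functions on $X$. Let $C_0,\dots,C_r$ be the irreducible components of the divisors of $f_1,f_2,f_3$. Assume that every $C_i$ is non-singular and that the components have normal crossings (at an intersection point only two components meet, and they meet transversally). Put $n_{ki}=\mathrm{ord}_{C_i}f_k$ and $m_k=n_{k0}$. For each $i$ let $x_i$ be a rational function on $X$ with $\mathrm{ord}_{C_j}x_i=\delta_{ij}$ for all $j$ ($x_i$ may have other zeros and poles); the same $x_0$ is used at all points of $C_0$. Let $\{P_1,\dots,P_s\}=C_0\cap\bigcup_{j\ge1}C_j$. At $P_i\in C_0\cap C_j$ put $n_k=n_{kj}$ and define $g_k$ by $f_k=x_0^{m_k}x_j^{n_k}g_k$; $x_0,x_j$ define $C_0,C_j$ near $P_i$, so $g_k$ is well defined and non-zero at $P_i$. Parshin symbol: $\{f_1,f_2,f_3\}_{C_0,P_i}=(-1)^K g_1(P_i)^{D_1}g_2(P_i)^{D_2}g_3(P_i)^{D_3}$, where $D_1=m_2n_3-m_3n_2$, $D_2=m_3n_1-m_1n_3$, $D_3=m_1n_2-m_2n_1$ and $K=n_1n_2m_3+n_2n_3m_1+n_3n_1m_2-m_1m_2n_3-m_2m_3n_1-m_3m_1n_2$.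 Let $g$ be the genus of $C_0$ and $Q\in C_0$ a base point different from all $P_i$. Let $R_i\in C_0$ be a point in an $\epsilon$-neighbourhood of $P_i$, $\gamma_i$ a path on $C_0$ from $Q$ to $R_i$, $\sigma_i^0$ a small simple loop around $P_i$ based at $R_i$, and $\sigma_i=\gamma_i\sigma_i^0\gamma_i^{-1}$. Let $\alpha_j,\beta_j$ ($1\le j\le g$) be loops around the handles of $C_0$ based at $Q$; the paths are chosen so that $\prod_{j=1}^g[\alpha_j,\beta_j]\prod_{i=1}^s\sigma_i$ is homotopic to the trivial loop at $Q$ in $C_0\setminus\{P_1,\dots,P_s\}$. The point $Q$ and the paths avoid the zeros and poles of the functions being integrated; $dg_k/g_k$ is restricted to $C_0$. Put $$\mathrm{Log}(f_1,f_2,f_3)^{x_0,\gamma_i}_{C_0,P_i}=(2\pi i)^2\left(\pi i(m_2n_1n_3-n_2m_1m_3)+m_2n_3\int_{\gamma_i}\frac{dg_1}{g_1}-m_2n_1\int_{\gamma_i}\frac{dg_3}{g_3}\right),$$ with the integrals understood in the limit $\epsilon\to0$, i.e. with $R_i\to P_i$. The logarithm of the Parshin symbol is the sum over cyclic permutations $$\mathrm{Log}\{f_1,f_2,f_3\}^{\gamma_i}_{C_0,P_i}=\mathrm{Log}(f_1,f_2,f_3)^{x_0,\gamma_i}_{C_0,P_i}+\mathrm{Log}(f_2,f_3,f_1)^{x_0,\gamma_i}_{C_0,P_i}+\mathrm{Log}(f_3,f_1,f_2)^{x_0,\gamma_i}_{C_0,P_i},$$ where the indices of $m_k,n_k,g_k$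 are permuted accordingly. (In $\pi i$, $2\pi i$ the letter $i$ is the imaginary unit.) *)

(* Defs.v *)
From HB Require Import structures.
From mathcomp Require Import all_boot all_order all_algebra.
From mathcomp Require Import complex.
(* The notations of [mpoly] clash with those of MathComp-Analysis. *)
From mathcomp Require Import -(notations) mpoly.
From mathcomp Require Import all_classical all_reals all_analysis.

Set Implicit Arguments.
Unset Strict Implicit.
Unset Printing Implicit Defensive.

Import Order.TTheory GRing.Theory Num.Theory.
Import numFieldNormedType.Exports.

Local Open Scope classical_set_scope.
Local Open Scope ring_scope.
Local Open Scope complex_scope.

(* Points of P^N(C) are represented by non-zero vectors of C^(N+1), up to
   [same_pt]; subsets of P^N are sets of such vectors, stable under scaling. *)
Section Projective.
Variables (R : realType) (N : nat).

Definition hvec := 'rV[R[i]]_N.+1.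
Definition hpoly := mpoly N.+1 R[i].

Definition same_pt (v w : hvec) := exists2 c : R[i], c != 0 & w = c *: v.

Definition peval (F : hpoly) (v : hvec) : R[i] := meval (fun i => v 0 i) F.

Definition is_homog (d : nat) (F : hpoly) : bool := F \is ishomog1 d mdeg.

Definition pt (v : hvec) : set hvec := [set w | same_pt v w].

Definition vanish (Z : set hvec) (F : hpoly) := forall v, Z v -> peval F v = 0.

Definition zclosed (Z : set hvec) := exists2 S : set hpoly,
  (forall F, S F -> exists d, is_homog d F) &
  Z = [set v | v != 0 /\ forall F, S F -> peval F v = 0].

Definition zirreducible (Z : set hvec) :=
  [/\ zclosed Z, Z !=set0 &
      forall A B, zclosed A -> zclosed B -> Z `<=` A `|` B ->
                  Z `<=` A \/ Z `<=` B].

Definition irr_chain (Z : set hvec) (d : nat) :=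
  exists2 c : nat -> set hvec,
    (forall i, (i <= d)%N -> zirreducible (c i) /\ c i `<=` Z) &
    (forall i, (i < d)%N -> c i `<` c i.+1).

Definition has_dim (Z : set hvec) (d : nat) :=
  irr_chain Z d /\ ~ irr_chain Z d.+1.

(* Zariski tangent space of the affine cone over Z at v: the kernel of the
   Jacobian matrix of all the equations of Z.  It contains v itself, and its
   dimension is 1 + dim T_v Z. *)
Definition cone_tangent (Z : set hvec) (v : hvec) : set hvec :=
  [set w | forall d F, is_homog d F -> vanish Z F ->
     \sum_i w 0 i * peval (mderiv i F) v = 0].

(* Jacobian criterion: the rank of the Jacobian matrix is N - dim Z. *)
Definition nonsingular (Z : set hvec) := exists2 d, has_dim Z d &
  forall v, Z v -> exists2 A : 'M[R[i]]_(d.+1, N.+1), row_free A &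
    forall w, cone_tangent Z v w <-> (w <= A)%MS.

Definition smooth_projective_surface (X : set hvec) :=
  [/\ zirreducible X, has_dim X 2 & nonsingular X].

Definition irr_curve (X Z : set hvec) :=
  [/\ zirreducible Z, Z `<=` X & has_dim Z 1].

(* T_v Z1 + T_v Z2 = T_v X *)
Definition meet_transversally (X Z1 Z2 : set hvec) (v : hvec) :=
  forall w, cone_tangent X v w ->
    exists w1 w2, [/\ cone_tangent Z1 v w1, cone_tangent Z2 v w2 & w = w1 + w2].

(* The pair (a, b) represents the rational function a / b. *)
Definition rfun := (hpoly * hpoly)%type.

Definition ratfun (Z : set hvec) (f : rfun) :=
  (exists d, is_homog d f.1 /\ is_homog d f.2) /\ ~ vanish Z f.2.

Definition req (Z : set hvec) (f g : rfun) := vanish Z (f.1 * g.2 - g.1 * f.2).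

Definition rmul (f g : rfun) : rfun := (f.1 * g.1, f.2 * g.2).

Definition rpow (f : rfun) (n : int) : rfun :=
  match n with
  | Posz k => (f.1 ^+ k, f.2 ^+ k)
  | Negz k => (f.2 ^+ k.+1, f.1 ^+ k.+1)
  end.

(* O_{X,W}, the local ring of X along the irreducible closed subset W (along
   a curve, or at a point when W = pt P), and its group of units. *)
Definition in_local_ring (X W : set hvec) (f : rfun) :=
  exists h, [/\ ratfun X h, req X f h & ~ vanish W h.2].

Definition local_unit (X W : set hvec) (f : rfun) :=
  exists h, [/\ ratfun X h, req X f h, ~ vanish W h.2 & ~ vanish W h.1].

Definition in_local_ideal (X W Z : set hvec) (f : rfun) :=
  exists h, [/\ ratfun X h, req X f h, ~ vanish W h.2 & vanish Z h.1].

(* t generates the ideal of Z in O_{X,W}. *)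
Definition local_equation (X W Z : set hvec) (t : rfun) :=
  [/\ ratfun X t, in_local_ideal X W Z t &
      forall a, ratfun X a -> in_local_ideal X W Z a ->
        exists b, [/\ ratfun X b, in_local_ring X W b & req X a (rmul t b)]].

(* ord_Z f = n: f = t^n u, with t a uniformizer and u a unit of O_{X,Z}. *)
Definition is_ord (X Z : set hvec) (f : rfun) (n : int) :=
  exists t u, [/\ local_equation X Z Z t, ratfun X u, local_unit X Z u &
                  req X f (rmul (rpow t n) u)].

(* z is the value at v of the restriction to Z of the rational function f on
   X: h is a representative of f that can be restricted to Z, and h' is a
   representative of the restriction, in the function field of Z, that is
   regular at v. *)
Definition is_rvalue (X Z : set hvec) (f : rfun) (v : hvec) (z : R[i]) :=
  exists h h', [/\ ratfun X h, req X f h & ~ vanish Z h.2] /\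
    [/\ ratfun Z h', req Z h h', peval h'.2 v != 0
      & z = peval h'.1 v / peval h'.2 v].

Definition rvalue (X Z : set hvec) (f : rfun) (v : hvec) : R[i] :=
  xget 0 [set z | is_rvalue X Z f v z].

Definition no_zero_pole (X Z : set hvec) (f : rfun) (v : hvec) :=
  exists2 z, z != 0 & is_rvalue X Z f v z.

End Projective.

Section Analytic.
Variables (R : realType) (N : nat).
Local Notation hvec := (hvec R N).
Local Notation rfun := (rfun R N).

Definition chart (i : 'I_N.+1) (v : hvec) : hvec := (v 0 i)^-1 *: v.

(* Continuity of a map into P^N, read in an affine chart around each value.
   The coordinate l = i forces c s 0 i != 0 for s near t, since 0^-1 = 0. *)
Definition pcontinuous (T : topologicalType) (A : set T) (c : T -> hvec) :=
  forall t, A t -> exists2 i, c t 0 i != 0 &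
    forall l, ((chart i (c s) 0 l : R[i]^o) @[s --> within A (nbhs t)]
               --> (chart i (c t) 0 l : R[i]^o)).

Definition C1 (h : R -> R) :=
  (forall t, derivable h t 1) /\ continuous (derive1 h).

Definition pC1 (A : set R) (c : R -> hvec) :=
  forall t, A t -> exists i, exists h : 'I_N.+1 -> R -> R[i],
    (forall l, C1 (fun s => complex.Re (h l s)) /\
               C1 (fun s => complex.Im (h l s))) /\
    \forall s \near within A (nbhs t),
      c s 0 i != 0 /\ forall l, chart i (c s) 0 l = h l s.

Definition piecewise_C1 (a b : R) (c : R -> hvec) :=
  exists n, exists tau : nat -> R,
    [/\ tau 0%N = a, tau n = b,
        forall k, (k < n)%N -> tau k < tau k.+1 &
        forall k, (k < n)%N -> pC1 `[tau k, tau k.+1] c].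

Definition cderive (F : R -> R[i]) (t : R) : R[i] :=
  (derive1 (fun s => complex.Re (F s)) t) +i*
  (derive1 (fun s => complex.Im (F s)) t).

Definition cintegral (a b : R) (F : R -> R[i]) : R[i] :=
  (\int[lebesgue_measure]_(t in `[a, b]) complex.Re (F t))%R +i*
  (\int[lebesgue_measure]_(t in `[a, b]) complex.Im (F t))%R.

(* The integral of dg/g, restricted to Z, along c from c(a) to c(b). *)
Definition dlog_int (X Z : set hvec) (g : rfun) (c : R -> hvec) (a b : R)
    : R[i] :=
  let F t := rvalue X Z g (c t) in
  cintegral a b (fun t => cderive F t / F t).

Definition cexp (z : R[i]) : R[i] :=
  (expR (complex.Re z) * cos (complex.Im z)) +i*
  (expR (complex.Re z) * sin (complex.Im z)).

Definition pi_i : R[i] := 0 +i* pi.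

(* Paths in P^N are parametrized by [0, 1]. *)
Definition unit_itv : set R := `[0, 1].

Definition path_in (U : set hvec) (c : R -> hvec) :=
  pcontinuous unit_itv c /\ forall t, unit_itv t -> U (c t).

Definition loop_at (U : set hvec) (Q : hvec) (c : R -> hvec) :=
  [/\ path_in U c, same_pt Q (c 0) & same_pt Q (c 1)].

Definition simple_loop (c : R -> hvec) :=
  forall t u, unit_itv t -> unit_itv u -> same_pt (c t) (c u) ->
    [\/ t = u, t = 0 /\ u = 1 | t = 1 /\ u = 0].

Definition pcat (c d : R -> hvec) (t : R) : hvec :=
  if t <= 2^-1 then c (2 * t) else d (2 * t - 1).

Definition prevert (c : R -> hvec) (t : R) : hvec := c (1 - t).

Definition pprod (Q : hvec) (s : seq (R -> hvec)) : R -> hvec :=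
  foldr pcat (fun=> Q) s.

Definition pcommutators (g : nat) (al be : 'I_g -> R -> hvec)
    : seq (R -> hvec) :=
  flatten [seq [:: al j; be j; prevert (al j); prevert (be j)] | j <- enum 'I_g].

Definition homotopic (U : set hvec) (c d : R -> hvec) :=
  exists H : R * R -> hvec,
    [/\ pcontinuous (unit_itv `*` unit_itv) H,
        forall p, (unit_itv `*` unit_itv) p -> U (H p),
        forall t, unit_itv t -> same_pt (c t) (H (0, t)) /\
                                same_pt (d t) (H (1, t)) &
        forall s, unit_itv s -> same_pt (c 0) (H (s, 0)) /\
                                same_pt (c 1) (H (s, 1))].

(* S is obtained from a disc by gluing its boundary along the word
   prod_j [a_j, b_j], i.e. S is a closed oriented surface of genus g and the
   a_j, b_j are simple loops around its handles, meeting only at Q.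
   [Phi (rho, s)] are polar coordinates on the disc. *)
Definition genus_polygon (S : set hvec) (Q : hvec) (g : nat)
    (a b : 'I_g -> R -> hvec) :=
  let side (e : 'I_g + 'I_g) := match e with inl j => a j | inr j => b j end in
  [/\ S Q, (forall e, loop_at S Q (side e)),
      (forall e e' t u, unit_itv t -> unit_itv u ->
         same_pt (side e t) (side e' u) ->
         (e = e' /\ t = u) \/ ((t = 0 \/ t = 1) /\ (u = 0 \/ u = 1))) &
      exists Phi : R * R -> hvec,
       [/\ pcontinuous (unit_itv `*` unit_itv) Phi,
           (forall p, (unit_itv `*` unit_itv) p -> S (Phi p)),
           (forall v, S v ->
              exists2 p, (unit_itv `*` unit_itv) p & same_pt v (Phi p)),
           (forall s, unit_itv s ->
              [/\ same_pt (Phi (1, s)) (pprod Q (pcommutators a b) s),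
                  same_pt (Phi (0, s)) (Phi (0, 0)) &
                  same_pt (Phi (s, 0)) (Phi (s, 1))]) &
           (forall rho s rho' s', unit_itv rho -> unit_itv s ->
              unit_itv rho' -> unit_itv s' -> rho < 1 ->
              same_pt (Phi (rho, s)) (Phi (rho', s')) ->
              rho = rho' /\
              [\/ rho = 0, s = s', s = 0 /\ s' = 1 | s = 1 /\ s' = 0])]].

Definition has_genus (S : set hvec) (g : nat) :=
  exists Q (a b : 'I_g -> R -> hvec), genus_polygon S Q a b.

Definition handle_loops (S : set hvec) (Q : hvec) (g : nat)
    (al be : 'I_g -> R -> hvec) :=
  exists a b, genus_polygon S Q a b /\
    forall j, homotopic S (al j) (a j) /\ homotopic S (be j) (b j).

Definition punctured (S : set hvec) (s : nat) (P : 'I_s -> hvec) : set hvec :=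
  [set v | S v /\ forall i, ~ same_pt (P i) v].

(* [gam] runs from Q to P, avoids the punctures before time 1 and is piecewise
   C^1 on every [0, T] with T < 1.  With R_eps := gam (1 - eps), the path from
   Q to R_eps is the restriction of gam to [0, 1 - eps]. *)
Definition limit_path (U : set hvec) (Q P : hvec) (gam : R -> hvec) :=
  [/\ pcontinuous unit_itv gam,
      forall t, 0 <= t < 1 -> U (gam t),
      same_pt Q (gam 0), same_pt P (gam 1) &
      forall T, 0 < T < 1 -> piecewise_C1 0 T gam].

Definition ptrunc (eps : R) (gam : R -> hvec) (t : R) : hvec :=
  gam ((1 - eps) * t).

(* A simple loop in U, based at R0, going once around the zero of the local
   coordinate z (a rational function on X, restricted to the curve Z). *)
Definition simple_loop_around (X Z U : set hvec) (z : rfun) (R0 : hvec)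
    (c : R -> hvec) :=
  [/\ loop_at U R0 c, simple_loop c, piecewise_C1 0 1 c &
      dlog_int X Z z c 0 1 = 2 * pi_i].

(* The loops c eps shrink to the point P as eps tends to 0. *)
Definition shrinks_to (P : hvec) (c : R -> R -> hvec) :=
  exists2 i, P 0 i != 0 & forall d : R, 0 < d ->
    \forall eps \near 0^'+, forall t, unit_itv t -> forall l,
      `|chart i (c eps t) 0 l - chart i P 0 l| < d%:C.

(* The integral of dg/g along gam, understood in the limit R_eps -> P. *)
Definition dlog_lim (X Z : set hvec) (g : rfun) (gam : R -> hvec) : R[i] :=
  lim ((dlog_int X Z g gam 0 (1 - eps) : R[i]^o) @[eps --> 0^'+]).

(* D_1, D_2, D_3 are the values at k = 0, 1, 2: k + 1 and k + 2 are taken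
   modulo 3 in 'I_3. *)
Definition parshin_D (m n : 'I_3 -> int) (k : 'I_3) : int :=
  m (k + 1) * n (k + 2) - m (k + 2) * n (k + 1).

Definition parshin_K (m n : 'I_3 -> int) : int :=
  n 0 * n 1 * m 2 + n 1 * n 2 * m 0 + n 2 * n 0 * m 1
  - m 0 * m 1 * n 2 - m 1 * m 2 * n 0 - m 2 * m 0 * n 1.

Definition parshin_symbol (X : set hvec) (P : hvec) (m n : 'I_3 -> int)
    (g : 'I_3 -> rfun) : R[i] :=
  (-1) ^ parshin_K m n * \prod_(k < 3) rvalue X X (g k) P ^ parshin_D m n k.

(* Log(f_a, f_b, f_c) along gam, for (a, b, c) a permutation of the indices. *)
Definition log_parshin1 (X Z : set hvec) (gam : R -> hvec) (m n : 'I_3 -> int)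
    (g : 'I_3 -> rfun) (a b c : 'I_3) : R[i] :=
  (2 * pi_i) ^+ 2 *
  (pi_i * (m b * n a * n c - n b * m a * m c)%:~R
   + (m b * n c)%:~R * dlog_lim X Z (g a) gam
   - (m b * n a)%:~R * dlog_lim X Z (g c) gam).

Definition log_parshin (X Z : set hvec) (gam : R -> hvec) (m n : 'I_3 -> int)
    (g : 'I_3 -> rfun) : R[i] :=
  log_parshin1 X Z gam m n g 0 1 2 + log_parshin1 X Z gam m n g 1 2 0
  + log_parshin1 X Z gam m n g 2 0 1.

End Analytic.

(* Main.v *)
(* Collecting the coefficients of the integrals, (2 pi i)^-2 Log{f1,f2,f3} is
   pi i K + sum_k D_k I_k, where I_k is the integral of dg_k/g_k from Q to P_i.
   It remains to see that exp I_k = g_k(P_i) / g_k(Q).  Along the path, g_k is a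
   piecewise C^1 function F with values in C^*; F * exp(- int F'/F) has zero
   derivative, so the exponential of the integral up to time t is F(t) / F(0).
   As t -> 1 this tends to the non-zero number g_k(P_i) / g_k(Q), since g_k is
   a unit at P_i; hence the integral itself, a continuous logarithm, converges,
   and its limit is a logarithm of that number. *)
Require Import Defs.
From mathcomp Require Import all_boot all_order all_algebra.
From mathcomp Require Import complex.
From mathcomp Require Import -(notations) mpoly.
From mathcomp Require Import all_classical all_reals all_analysis.
From mathcomp Require Import measurable_realfun ring lra.
Import Order.TTheory GRing.Theory Num.Theory.
Import numFieldNormedType.Exports.
Local Open Scope classical_set_scope.
Local Open Scope ring_scope.
Local Open Scope complex_scope.

(** [rvalue] and [lim] are total functions, so a value must be exhibited and shown unique, and a
    limit shown to exist, before either can be computed. Uniqueness comes from the irreducibility of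
    $X$ and $C_0$. For the limit, the obstacle is that [cexp] forgets multiples of $2\pi i$:
    convergence of the exponential alone would allow jumps from one turn to another. Continuity
    excludes them, since an angle whose cosine and sine are almost constant cannot cross to the next
    turn. The path need not be piecewise $C^1$ up to $P_i$, so integration stops at T < 1 and only
    continuity is used at the end. Two features of the encoding shape the rest. A path is a family
    of homogeneous vectors whose scaling may jump, so functions are read on chart coordinates. And
    [cderive] may be a junk value at end points and break points: these form a null set, but the
    continuity arguments need the one-sided derivative there. *)

Section RationalFunctions.
Set Implicit Arguments.
Unset Strict Implicit.
Context {R : realType} {N : nat}.
Implicit Types (X Z : set (hvec R N)) (F G : hpoly R N) (f h : rfun R N).
Implicit Types (v w : hvec R N).

(** Polynomials are generated by constants and coordinates under sums and products. [A] is a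
    predicate on whole functions of [t], so that one induction serves both convergence and $C^1$
    regularity along a path. *)
Lemma peval_closed (T : Type) (A : (T -> R[i]) -> Prop) (c : T -> hvec R N) :
  (forall a, A (fun=> a)) ->
  (forall a b, A a -> A b -> A (fun t => a t + b t)) ->
  (forall a b, A a -> A b -> A (fun t => a t * b t)) ->
  (forall i, A (fun t => c t 0 i)) -> forall F, A (fun t => peval F (c t)).
Proof.
move=> Acst AD AM Ac F.
rewrite (_ : (fun t => _) = fun t => \sum_(m <- msupp F)
    mcoeff m F * \prod_i c t 0 i ^+ m i); last by apply/funext => t; rewrite /peval mevalE.
elim: (msupp F) => [|m s ihs].
  by rewrite (_ : (fun t => _) = fun=> 0)//; apply/funext => t; rewrite big_nil.
rewrite (_ : (fun t => _) = fun t => mcoeff m F * \prod_i c t 0 i ^+ m i +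
    \sum_(m <- s) mcoeff m F * \prod_i c t 0 i ^+ m i); last first.
  by apply/funext => t; rewrite big_cons.
apply: (AD) => //; apply: (AM) => //.
elim: (index_enum _) => [|i e ihe].
  by rewrite (_ : (fun t => _) = fun=> 1)//; apply/funext => t; rewrite big_nil.
rewrite (_ : (fun t => _) = fun t => c t 0 i ^+ m i *
    \prod_(i <- e) c t 0 i ^+ m i); last by apply/funext => t; rewrite big_cons.
apply: (AM) => //; elim: (m i) => [|k ihk]; first exact: Acst.
by under eq_fun do rewrite exprS; exact: AM.
Qed.

(** * Equality and values of rational functions on irreducible sets *)

Lemma peval_scale d F a v : is_homog d F ->
  peval F (a *: v) = a ^+ d * peval F v.
Proof.
move=> /dhomogP homF; rewrite /peval !mevalE mulr_sumr.
rewrite !big_seq; apply: eq_bigr => m mF; rewrite -(homF m mF).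
rewrite mulrCA; congr (_ * _); rewrite [X in a ^+ X]mdegE -prodrXr.
by rewrite -big_split/=; apply: eq_bigr => i _; rewrite mxE exprMn.
Qed.

Lemma is_homogM d e F G : is_homog d F -> is_homog e G -> is_homog (d + e) (F * G).
Proof. exact: dhomogM. Qed.

Lemma is_homogB d F G : is_homog d F -> is_homog d G -> is_homog d (F - G).
Proof. exact: rpredB. Qed.

Lemma zirreducible_neq0 Z v : zirreducible Z -> Z v -> v != 0.
Proof. by move=> [[S _ ->] _ _] []. Qed.

(** Homogeneity makes the zero loci of [F] and [G] closed; together they cover [Z], and
    irreducibility puts [Z] inside one of them. *)
Lemma vanish_mul Z d e F G : zirreducible Z -> is_homog d F -> is_homog e G ->
  vanish Z (F * G) -> vanish Z F \/ vanish Z G.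
Proof.
move=> Zirr homF homG FG0; have [_ _ Zsplit] := Zirr.
pose V H := [set v : hvec R N | v != 0 /\ forall H', [set H] H' -> peval H' v = 0].
have Vclosed k H : is_homog k H -> zclosed (V H).
  by move=> homH; exists [set H] => // _ ->; exists k.
have [v Zv||] := Zsplit (V F) (V G) (Vclosed _ _ homF) (Vclosed _ _ homG).
- have v0 := zirreducible_neq0 Zirr Zv.
  have /eqP := FG0 v Zv; rewrite /peval mevalM mulf_eq0 => /orP[] /eqP z0.
    by left; split => // _ ->.
  by right; split => // _ ->.
- by move=> ZF; left => v /ZF[_ /(_ F)]; exact.
- by move=> ZG; right => v /ZG[_ /(_ G)]; exact.
Qed.

Lemma reqC X f h : req X f h -> req X h f.
Proof.
by move=> fh v /fh; rewrite /peval !mevalB !mevalM => /eqP;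
   rewrite subr_eq0 => /eqP ->; rewrite subrr.
Qed.

(** Multiplied by [f.2], the cross difference of [h] and [k] vanishes on [X]; [f.2] can be cancelled
    because it is not identically zero on the irreducible [X]. *)
Lemma req_trans X f h k : zirreducible X ->
  ratfun X f -> ratfun X h -> ratfun X k ->
  req X h f -> req X f k -> req X h k.
Proof.
move=> Xirr [[d [f1 f2]] nf] [[e [h1 h2]] nh] [[l [k1 k2]] nk] hf fk.
have homE : is_homog (e + l) (h.1 * k.2 - k.1 * h.2).
  by apply: is_homogB; [|rewrite addnC]; exact: is_homogM.
have [v Xv|//|//] := vanish_mul (G := f.2) Xirr homE f2.
have := hf v Xv; have := fk v Xv; rewrite /peval !(mevalB, mevalM).
move=> /eqP; rewrite subr_eq0 => /eqP E1 /eqP; rewrite subr_eq0 => /eqP E2.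
rewrite mulrBl [X in X - _]mulrAC E2.
rewrite [X in _ - X]mulrAC -[X in _ - X * _]E1; ring.
Qed.

(** Two representatives on [X] agree on [Z] by transitivity through [f]; transitivity on [Z] carries
    this over to their restrictions, whose denominators are non-zero at [v]. *)
Lemma is_rvalue_unique X Z f v z z' : zirreducible X -> zirreducible Z ->
  Z `<=` X -> ratfun X f -> Z v ->
  is_rvalue X Z f v z -> is_rvalue X Z f v z' -> z = z'.
Proof.
move=> Xirr Zirr ZX rf Zv [h [h' [[rh hf nh] [rh' hh' nh' ->]]]].
move=> [k [k' [[rk kf nk] [rk' kk' nk' ->]]]].
have ratZ l : ratfun X l -> ~ vanish Z l.2 -> ratfun Z l by move=> [].
have hk : req Z h k.
  by move=> w /ZX; apply: (req_trans Xirr rf) => //; exact: reqC.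
have hk' : req Z h k' by apply: (req_trans Zirr (ratZ k _ _)) => //; exact: ratZ.
have : req Z h' k' by apply: (req_trans Zirr (ratZ h _ _)) => //; exact: reqC.
move=> /(_ v Zv); rewrite /peval mevalB !mevalM => /eqP.
by rewrite subr_eq0 => /eqP E; apply/eqP; rewrite eqr_div//; apply/eqP.
Qed.

Lemma rvalueE X Z f v z : zirreducible X -> zirreducible Z ->
  Z `<=` X -> ratfun X f -> Z v -> is_rvalue X Z f v z -> rvalue X Z f v = z.
Proof.
move=> Xirr Zirr ZX rf Zv fz; rewrite /rvalue; case: xgetP => [y _ fy|].
  exact: (is_rvalue_unique Xirr Zirr ZX rf Zv).
by move=> /(_ z).
Qed.

Lemma ratio_scale Z h a v : ratfun Z h -> a != 0 ->
  peval h.1 (a *: v) / peval h.2 (a *: v) = peval h.1 v / peval h.2 v.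
Proof.
move=> [[d [h1 h2]] _] a0; rewrite !(@peval_scale d)//.
by rewrite -mulf_div divff ?mul1r// expf_neq0.
Qed.

Lemma is_rvalue_same_pt X Z f v w z :
  same_pt v w -> is_rvalue X Z f v z -> is_rvalue X Z f w z.
Proof.
move=> [a a0 ->] [h [h' [? [rh' hh' nh' ->]]]]; exists h, h'; split => //.
split => //; last by rewrite (ratio_scale _ rh').
by case: rh' => -[d [_ h2]] _; rewrite (@peval_scale d)// mulf_neq0// expf_neq0.
Qed.

(** A single fraction computes the value for every [Z] through [v]. This identifies the value on the
    surface, used by the Parshin symbol, with the value on $C_0$ that the path approaches. *)
Lemma local_unit_ratio X f v : local_unit X (pt v) f -> exists h,
  [/\ peval h.1 v != 0, peval h.2 v != 0 &
      forall Z, Z v -> is_rvalue X Z f v (peval h.1 v / peval h.2 v)].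
Proof.
move=> [h [rh hf nh2 nh1]]; exists h.
have nz d F : is_homog d F -> ~ vanish (pt v) F -> peval F v != 0.
  move=> homF nF; apply: contra_notN nF => /eqP Fv _ [a a0 ->].
  by rewrite (@peval_scale d)// Fv mulr0.
case: (rh) => -[d [h1 h2]] _.
split; [exact: nz h1 nh1|exact: nz h2 nh2|move=> Z Zv].
have nZ : ~ vanish Z h.2.
  by move=> /(_ v Zv) h2v; have := nz _ _ h2 nh2; rewrite h2v eqxx.
exists h, h; split=> //; split => //; first by split=> //; case: rh.
- by move=> w _; rewrite subrr /peval meval0.
- exact: nz h2 nh2.
Qed.

End RationalFunctions.

(** * Convergence in [R[i]] through real and imaginary parts *)

Section ComplexParts.
Context {R : realType}.
Set Implicit Arguments.
Unset Strict Implicit.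
Implicit Types (z w : R[i]) (F G : R -> R[i]).
Local Notation Re := complex.Re.
Local Notation Im := complex.Im.

Lemma complex_ReD z w : Re (z + w) = Re z + Re w.
Proof. by case: z w => [? ?] [? ?]. Qed.

Lemma complex_ImD z w : Im (z + w) = Im z + Im w.
Proof. by case: z w => [? ?] [? ?]. Qed.

Lemma complex_ReM z w : Re (z * w) = Re z * Re w - Im z * Im w.
Proof. by case: z w => [? ?] [? ?]. Qed.

Lemma complex_ImM z w : Im (z * w) = Re z * Im w + Im z * Re w.
Proof. by case: z w => [? ?] [? ?]. Qed.

Lemma complex_ReV z : Re z^-1 = Re z / (Re z ^+ 2 + Im z ^+ 2).
Proof. by case: z. Qed.

Lemma complex_ImV z : Im z^-1 = - Im z / (Re z ^+ 2 + Im z ^+ 2).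
Proof. by case: z => a b; rewrite /= mulNr. Qed.

Lemma complex_inj z w : Re z = Re w -> Im z = Im w -> z = w.
Proof. by case: z w => [? ?] [? ?] /= -> ->. Qed.

Lemma sqr_norm_neq0 z : z != 0 -> Re z ^+ 2 + Im z ^+ 2 != 0.
Proof.
apply: contraNN; rewrite paddr_eq0 ?sqr_ge0// !sqrf_eq0 => /andP[/eqP zr /eqP zi].
by apply/eqP/complex_inj.
Qed.

(** [C1], [cintegral] and [cexp] are defined by parts, so limits are too; [cvg_partsP] links this
    with the topology of [R[i]^o] used by [pcontinuous] and [dlog_lim]. *)
Definition cvg_parts (T : Type) (FF : set_system T) (f : T -> R[i]) (l : R[i]) :=
  (Re (f t) @[t --> FF] --> Re l) /\ (Im (f t) @[t --> FF] --> Im l).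

Section CvgParts.
Variables (T : Type) (FF : set_system T).
Hypothesis FFF : Filter FF.
Implicit Types (f g : T -> R[i]) (l k : R[i]).

Lemma cvg_parts_cst l : cvg_parts FF (fun=> l) l.
Proof. by split; exact: cvg_cst. Qed.

Lemma cvg_partsD f g l k : cvg_parts FF f l -> cvg_parts FF g k ->
  cvg_parts FF (fun t => f t + g t) (l + k).
Proof.
move=> [fr fi] [gr gi]; split.
  by under eq_fun do rewrite complex_ReD; rewrite complex_ReD; exact: cvgD.
by under eq_fun do rewrite complex_ImD; rewrite complex_ImD; exact: cvgD.
Qed.

Lemma cvg_partsM f g l k : cvg_parts FF f l -> cvg_parts FF g k ->
  cvg_parts FF (fun t => f t * g t) (l * k).
Proof.
move=> [fr fi] [gr gi]; split.
  by under eq_fun do rewrite complex_ReM; rewrite complex_ReM; apply: cvgB; exact: cvgM.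
by under eq_fun do rewrite complex_ImM; rewrite complex_ImM; apply: cvgD; exact: cvgM.
Qed.

Lemma cvg_partsV f l : l != 0 -> cvg_parts FF f l ->
  cvg_parts FF (fun t => (f t)^-1) l^-1.
Proof.
move=> /sqr_norm_neq0 l0 [fr fi].
have nV : (Re (f t) ^+ 2 + Im (f t) ^+ 2)^-1 @[t --> FF] -->
    (Re l ^+ 2 + Im l ^+ 2)^-1.
  by apply: cvgV => //; apply: cvgD; rewrite !expr2; under eq_fun do rewrite expr2;
     exact: cvgM.
split.
  by under eq_fun do rewrite complex_ReV; rewrite complex_ReV; exact: cvgM.
by under eq_fun do rewrite complex_ImV; rewrite complex_ImV; apply: cvgM => //; exact: cvgN.
Qed.

Lemma cvg_parts_neq0 f l : l != 0 -> cvg_parts FF f l ->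
  \forall t \near FF, f t != 0.
Proof.
rewrite eq_complex negb_and => /orP[l0 [fl _]|l0 [_ fl]].
  by near=> t; rewrite eq_complex negb_and; apply/orP; left; near: t; exact: (cvgr_neq0 _ fl).
by near=> t; rewrite eq_complex negb_and; apply/orP; right; near: t; exact: (cvgr_neq0 _ fl).
Unshelve. all: by end_near. Qed.

Lemma near_eq_cvg_parts f g l : (\forall t \near FF, f t = g t) ->
  cvg_parts FF f l -> cvg_parts FF g l.
Proof.
move=> fg [fr fi]; split.
  by apply: cvg_trans fr; apply: near_eq_cvg; apply: filterS fg => t ->.
by apply: cvg_trans fi; apply: near_eq_cvg; apply: filterS fg => t ->.
Qed.

(* The order on R[i] makes every positive radius real. *)
Lemma cvg_partsP f l : (f t : R[i]^o) @[t --> FF] --> (l : R[i]^o) <->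
  cvg_parts FF f l.
Proof.
have norm_le z : `|z| <= (`|Re z| + `|Im z|)%:C.
  rewrite normc_def lecR -(@ler_pXn2r _ 2%N) ?nnegrE ?sqrtr_ge0 ?addr_ge0//.
  rewrite sqr_sqrtr ?addr_ge0 ?sqr_ge0// sqrrD !real_normK ?num_real//.
  by rewrite -addrA lerD2l lerDr mulrn_wge0// mulr_ge0.
have norm_ge z : `|Re z|%:C <= `|z| /\ `|Im z|%:C <= `|z|.
  split; rewrite normc_def lecR -sqrtr_sqr ler_wsqrtr// ?lerDl ?lerDr sqr_ge0//.
split=> [/cvgrPdist_lt fl|[/cvgrPdist_lt fr /cvgrPdist_lt fi]].
- split; apply/cvgrPdist_lt => e e0.
    have := fl e%:C; rewrite ltcR => /(_ e0); apply: filterS => t.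
    move=> /(le_lt_trans (norm_ge _).1); rewrite ltcR.
    by case: (f t) (l) => [? ?] [? ?].
  have := fl e%:C; rewrite ltcR => /(_ e0); apply: filterS => t.
  move=> /(le_lt_trans (norm_ge _).2); rewrite ltcR.
  by case: (f t) (l) => [? ?] [? ?].
- apply/cvgrPdist_lt => -[e e']; rewrite ltcE/= => /andP[/eqP -> e0].
  have e20 : 0 < e / 2 by rewrite divr_gt0.
  near=> t.
  rewrite (le_lt_trans (norm_le _))// ltcR.
  have -> : Re (l - f t) = Re l - Re (f t) by case: (f t) (l) => [? ?] [? ?].
  have -> : Im (l - f t) = Im l - Im (f t) by case: (f t) (l) => [? ?] [? ?].
  rewrite [ltRHS]splitr ltrD//; near: t; [exact: fr|exact: fi].
Unshelve. all: by end_near. Qed.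

End CvgParts.

End ComplexParts.

(** * Functions that are $C^1$ near a point, or up to the ends of a segment *)

Section LocallyC1.
Context {R : realType}.
Set Implicit Arguments.
Unset Strict Implicit.
Implicit Types (p q : R -> R) (F G H : R -> R[i]) (t : R).
Local Notation Re := complex.Re.
Local Notation Im := complex.Im.

(** [C1] is global, whereas a quotient is $C^1$ only near points where its denominator is non-zero;
    hence this local form. *)
Definition C1_at p t := exists2 dp : R -> R,
  (\forall s \near t, is_derive s (1 : R) p (dp s)) & dp s @[s --> t] --> dp t.

Lemma C1_at_continuous p t : C1_at p t -> p s @[s --> t] --> p t.
Proof.
move=> [dp /nbhs_singleton[pt _] _].
exact/(@differentiable_continuous _ _ _ t p)/derivable1_diffP.
Qed.

Lemma C1_at_cst (a t : R) : C1_at (fun=> a) t.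
Proof.
exists (fun=> 0); last exact: cvg_cst.
by near=> s; exact: is_derive_cst.
Unshelve. all: by end_near. Qed.

Lemma C1_atD p q t : C1_at p t -> C1_at q t -> C1_at (fun s => p s + q s) t.
Proof.
move=> [dp pd dpc] [dq qd dqc]; exists (fun s => dp s + dq s); last exact: cvgD.
by apply: filterS2 pd qd => s; exact: is_deriveD.
Qed.

Lemma C1_atM p q t : C1_at p t -> C1_at q t -> C1_at (fun s => p s * q s) t.
Proof.
move=> pC qC; have [pc qc] := (C1_at_continuous pC, C1_at_continuous qC).
move: pC qC => [dp pd dpc] [dq qd dqc].
exists (fun s => p s * dq s + q s * dp s); last by apply: cvgD; exact: cvgM.
by apply: filterS2 pd qd => s; exact: is_deriveM.
Qed.

Lemma C1_atN p t : C1_at p t -> C1_at (fun s => - p s) t.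
Proof.
move=> [dp pd dpc]; exists (fun s => - dp s); last exact: cvgN.
by apply: filterS pd => s; exact: is_deriveN.
Qed.

Lemma C1_atV p t : p t != 0 -> C1_at p t -> C1_at (fun s => (p s)^-1) t.
Proof.
move=> p0 pC; have pc := C1_at_continuous pC.
move: pC => [dp pd dpc]; exists (fun s => - (p s) ^- 2 * dp s).
  apply: filterS2 pd (cvgr_neq0 _ pc p0) => s [ps <-] ps0.
  by apply: DeriveDef; [exact: derivableV|rewrite deriveV].
apply: cvgM => //; apply: cvgN; apply: cvgV; first by rewrite expf_neq0.
by rewrite expr2; under eq_fun do rewrite expr2; exact: cvgM.
Qed.

Lemma C1_C1_at p t : C1 p -> C1_at p t.
Proof.
move=> [pd dpc]; exists (derive1 p); last exact: dpc.
by near=> s; apply: DeriveDef => //; rewrite derive1E.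
Unshelve. all: by end_near. Qed.

Definition cC1_at F t := C1_at (fun s => Re (F s)) t /\ C1_at (fun s => Im (F s)) t.

Lemma cC1_at_continuous F t : cC1_at F t -> cvg_parts (nbhs t) F (F t).
Proof. by move=> [Fr Fi]; split; exact: C1_at_continuous. Qed.

Lemma cC1_at_cst (a : R[i]) t : cC1_at (fun=> a) t.
Proof. by split; exact: C1_at_cst. Qed.

Lemma cC1_atD F G t : cC1_at F t -> cC1_at G t -> cC1_at (fun s => F s + G s) t.
Proof.
move=> [Fr Fi] [Gr Gi]; split.
  by under eq_fun do rewrite complex_ReD; exact: C1_atD.
by under eq_fun do rewrite complex_ImD; exact: C1_atD.
Qed.

Lemma cC1_atM F G t : cC1_at F t -> cC1_at G t -> cC1_at (fun s => F s * G s) t.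
Proof.
move=> [Fr Fi] [Gr Gi]; split.
  by under eq_fun do rewrite complex_ReM; apply: C1_atD; [|apply: C1_atN]; exact: C1_atM.
by under eq_fun do rewrite complex_ImM; apply: C1_atD; exact: C1_atM.
Qed.

Lemma cC1_atV F t : F t != 0 -> cC1_at F t -> cC1_at (fun s => (F s)^-1) t.
Proof.
move=> /sqr_norm_neq0 F0 [Fr Fi].
have nV : C1_at (fun s => (Re (F s) ^+ 2 + Im (F s) ^+ 2)^-1) t.
  by apply: C1_atV => //; under eq_fun do rewrite !expr2;
     apply: C1_atD; exact: C1_atM.
split.
  by under eq_fun do rewrite complex_ReV; exact: C1_atM.
by under eq_fun do rewrite complex_ImV; apply: C1_atM => //; exact: C1_atN.
Qed.

Definition cC1_within (A : set R) F t := exists2 H, cC1_at H t &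
  \forall s \near within A (nbhs t), F s = H s.

(* On the interior, D is the derivative of F; at the end points, it is the
   one-sided derivative, whereas the derivative of F is a junk value there. *)
Lemma cC1_within_derivative F (a b : R) : a < b ->
  (forall t, a <= t <= b -> cC1_within `[a, b] F t) ->
  exists D : R -> R[i],
  [/\ forall t, a <= t <= b -> cvg_parts (within `[a, b] (nbhs t)) F (F t),
      forall t, a <= t <= b -> cvg_parts (within `[a, b] (nbhs t)) D (D t) &
      forall t, a < t < b ->
        is_derive t (1 : R) (fun s => Re (F s)) (Re (D t)) /\
        is_derive t (1 : R) (fun s => Im (F s)) (Im (D t))].
Proof.
move=> ab FC1.
have inside t : a < t < b -> \forall s \near t, `[a, b]%classic s.
  by move=> tab; apply: filterS (near_in_itvoo _) => [s|];
    [exact: subset_itv_oo_cc|rewrite in_itv].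
have /choice[D DP] t : exists d : R[i], a <= t <= b -> exists H dp dq,
    [/\ \forall s \near within `[a, b] (nbhs t), F s = H s,
        \forall s \near t, is_derive s (1 : R) (fun u => Re (H u)) (dp s) /\
                           is_derive s (1 : R) (fun u => Im (H u)) (dq s),
        dp s @[s --> t] --> dp t, dq s @[s --> t] --> dq t &
        d = dp t +i* dq t].
  have [tab|ntab] := boolP (a <= t <= b); last by exists 0.
  have [H [[dp pd dpc] [dq qd dqc]] FH] := FC1 t tab.
  exists (dp t +i* dq t) => _; exists H, dp, dq; split=> //.
  by apply: filterS2 pd qd.
have within_at t : a <= t <= b -> `[a, b]%classic t by rewrite /= in_itv.
have DE t H : a < t < b -> (\forall s \near within `[a, b] (nbhs t), F s = H s) ->
    \forall s \near t, F s = H s.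
  move=> tab FH; near=> s.
  suff : `[a, b]%classic s by near: s.
  by near: s; exact: inside.
have Dder t : a < t < b ->
    is_derive t (1 : R) (fun s => Re (F s)) (Re (D t)) /\
    is_derive t (1 : R) (fun s => Im (F s)) (Im (D t)).
  move=> /[dup] tab /andP[/ltW at_ /ltW tb].
  have [|H [dp [dq [FH /nbhs_singleton[pd qd] _ _ ->]]]] := DP t; first exact/andP.
  have {}FH := DE _ _ tab FH.
  by split; [apply: near_eq_is_derive pd|apply: near_eq_is_derive qd];
    apply: filterS FH => s ->.
exists D; split=> // t tab.
  have [H [dp [dq [FH HD _ _ _]]]] := DP t tab.
  have FHt : F t = H t by apply: (nbhs_singleton FH); exact: within_at.
  move: HD => /nbhs_singleton[[pd _] [qd _]].
  apply: near_eq_cvg_parts (_ : \forall s \near within _ _, H s = F s) _.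
    by apply: filterS FH => s ->.
  rewrite FHt; split; apply: cvg_within_filter.
    exact/(@differentiable_continuous _ _ _ t (fun s => Re (H s)))/derivable1_diffP.
  exact/(@differentiable_continuous _ _ _ t (fun s => Im (H s)))/derivable1_diffP.
have [H [dp [dq [FH HD dpc dqc Dt]]]] := DP t tab.
apply: (@near_eq_cvg_parts _ _ _ _ (fun s => dp s +i* dq s)); last first.
  by rewrite Dt; split; exact: cvg_within_filter.
(* The extension that defines [D s] was chosen at [s], not at [t]. A point [s] of the segment near
   [t] but different from [t] is interior, and there both extensions have the derivative of [F]; at
   [s = t] they agree by construction. *)
have awayP : \forall s \near t, s = t \/ (s != a /\ s != b).
  have away c : \forall s \near t, s = t \/ s != c.
    have [->|tc] := eqVneq t c; first by near=> s; case: (eqVneq s c); [left|right].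
    have : nbhs t [set s : R | s != c] by apply: open_nbhs_nbhs; split.
    by apply: filterS => s; right.
  apply: filterS2 (away a) (away b) => s [->|sa] [sb|sb]; by [left|left|right|].
have FHn : \forall s \near t, \forall u \near s, `[a, b]%classic u -> F u = H u.
  exact: (nbhs_interior FH).
have HD' : \forall s \near t, s != a /\ s != b -> `[a, b]%classic s ->
    Re (D s) = dp s /\ Im (D s) = dq s.
  near=> s; move=> [sa sb]; rewrite /= in_itv/= => /andP[as_ sb'].
  have sab : a < s < b by rewrite !lt_neqAle eq_sym sa as_ sb.
  have [pF qF] := Dder s sab.
  have [pH qH] : is_derive s (1 : R) (fun u => Re (H u)) (dp s) /\
                 is_derive s (1 : R) (fun u => Im (H u)) (dq s) by near: s.
  have FHs : \forall u \near s, F u = H u by apply: DE => //; near: s.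
  have {}pF : is_derive s (1 : R) (fun u => Re (H u)) (Re (D s)).
    by apply: near_eq_is_derive pF; apply: filterS FHs => u ->.
  have {}qF : is_derive s (1 : R) (fun u => Im (H u)) (Im (D s)).
    by apply: near_eq_is_derive qF; apply: filterS FHs => u ->.
  by case: pF qF pH qH => _ <- [_ <-] [_ ->] [_ ->].
change (nbhs t (fun s => `[a, b]%classic s -> dp s +i* dq s = D s)).
apply: filterS2 awayP HD' => s [->|sn] sD sab; first by rewrite Dt.
by have [Dr Di] := sD sn sab; apply: complex_inj; rewrite ?Dr ?Di.
Unshelve. all: by end_near. Qed.

End LocallyC1.

(** * The exponential of the integral of a logarithmic derivative over a segment *)

Section LogarithmicIntegral.
Context {R : realType}.
Set Implicit Arguments.
Unset Strict Implicit.
Implicit Types (f g : R -> R) (F G : R -> R[i]) (a b t : R).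
Local Notation Re := complex.Re.
Local Notation Im := complex.Im.
Local Notation mu := (@lebesgue_measure R).

(** The two end points form a null set, invisible to measurability and to the integral. This lets
    the logarithmic derivative built on [cderive F] be replaced by a continuous function. *)
Lemma integrable_segment_eq f g a b : {in `]a, b[, f =1 g} ->
  mu.-integrable `[a, b] (EFin \o g) -> mu.-integrable `[a, b] (EFin \o f).
Proof.
move=> fg /integrableP[/measurable_EFinP mg ig].
have sub : `]a, b[ `<=` `[a, b] := @subset_itv_oo_cc _ _ a b.
have mg' : measurable_fun `]a, b[ g by apply: measurable_funS mg.
have mf' : measurable_fun `]a, b[ f.
  by apply: eq_measurable_fun mg' => t; rewrite inE => /fg.
have mf : measurable_fun `[a, b] f.
  by apply/measurable_fun_itv_obnd_cbndP/measurable_fun_itv_bndo_bndcP.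
apply/integrableP; split; first exact/measurable_EFinP.
move: ig; rewrite integral_itv_bndoo; last exact/measurableT_comp/measurable_EFinP.
rewrite [X in _ -> (X < _)%E]integral_itv_bndoo; last first.
  exact/measurableT_comp/measurable_EFinP.
move=> ig; apply: le_lt_trans ig; rewrite le_eqVlt; apply/orP; left; apply/eqP.
by apply: eq_integral => t; rewrite inE => /fg /= ->.
Qed.

Lemma Rintegral_segment_eq f g a b : {in `]a, b[, f =1 g} ->
  mu.-integrable `[a, b] (EFin \o g) ->
  (\int[mu]_(t in `[a, b]) f t)%R = (\int[mu]_(t in `[a, b]) g t)%R.
Proof.
move=> fg ig; have := integrable_segment_eq fg ig.
move: ig => /integrableP[/measurable_EFinP mg _] /integrableP[/measurable_EFinP mf _].
have sub : `]a, b[ `<=` `[a, b] := @subset_itv_oo_cc _ _ a b.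
rewrite /Rintegral (@eq_integral_itv_bounded _ _ _ g)//.
- exact: measurable_funS mf.
- exact: measurable_funS mg.
Qed.

Lemma zero_derivative_eq f a b : a < b ->
  (forall t, a <= t <= b -> f s @[s --> within `[a, b] (nbhs t)] --> f t) ->
  (forall t, a < t < b -> is_derive t (1 : R) f 0) -> f b = f a.
Proof.
move=> ab fc fd.
have fd' t : t \in `]a, b[ -> is_derive t (1 : R) f ((fun=> 0) t).
  by rewrite in_itv/=; exact: fd.
have fc' : {within `[a, b], continuous f}.
  by apply/subspace_continuousP => t; rewrite /= in_itv/=; exact: fc.
have [t _ /eqP] := MVT ab fd' fc'.
by rewrite mul0r subr_eq0 => /eqP.
Qed.

Lemma within_segment_continuous f a b t : a < t < b ->
  f s @[s --> within `[a, b] (nbhs t)] --> f t -> f s @[s --> t] --> f t.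
Proof.
move=> tab ft A /ft fA.
have tin : \forall s \near t, s \in `]a, b[ by apply: near_in_itvoo; rewrite in_itv.
have fA' : \forall s \near t, `[a, b]%classic s -> A (f s) := fA.
change (\forall s \near t, A (f s)).
by apply: filterS2 fA' tin => s sA /subset_itv_oo_cc; exact: sA.
Qed.

Lemma integral_is_derive f a b t : a < t < b ->
  mu.-integrable `[a, b] (EFin \o f) -> f s @[s --> t] --> f t ->
  is_derive t (1 : R) (fun s => (\int[mu]_(u in `[a, s]) f u)%R) (f t).
Proof.
move=> /andP[at_ tb] fi ft.
have [dt dtE] := @continuous_FTC1_closed _ f a t b tb fi at_ ft.
rewrite derive1E in dtE.
exact: (DeriveDef dt dtE).
Qed.

Definition integrable_parts (A : set R) F :=
  mu.-integrable A (EFin \o (fun t => Re (F t))) /\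
  mu.-integrable A (EFin \o (fun t => Im (F t))).

(* F is recovered from its logarithmic derivative G because the function
   F * exp (- \int G) has zero derivative. *)
Lemma cexp_integral_segment F D a b : a < b ->
  (forall t, a <= t <= b -> F t != 0) ->
  (forall t, a <= t <= b -> cvg_parts (within `[a, b] (nbhs t)) F (F t)) ->
  (forall t, a <= t <= b -> cvg_parts (within `[a, b] (nbhs t)) D (D t)) ->
  (forall t, a < t < b ->
     is_derive t (1 : R) (fun s => Re (F s)) (Re (D t)) /\
     is_derive t (1 : R) (fun s => Im (F s)) (Im (D t))) ->
  integrable_parts `[a, b] (fun t => D t / F t) /\
  F b = F a * cexp (cintegral a b (fun t => D t / F t)).
Proof.
move=> ab F0 Fc Dc Fd; set G := fun t => D t / F t.
have GE t : G t = D t / F t by [].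
clearbody G.
have Gc t : a <= t <= b -> cvg_parts (within `[a, b] (nbhs t)) G (G t).
  move=> tab; rewrite GE (funext GE); apply: cvg_partsM; first exact: Dc.
  by apply: cvg_partsV; [exact: F0|exact: Fc].
have Gi : integrable_parts `[a, b] G.
  split; (apply: continuous_compact_integrable; first exact: segment_compact);
    apply/subspace_continuousP => t; rewrite /= in_itv/= => /Gc[Gr Gi].
    exact: Gr.
  exact: Gi.
split=> //.
pose U t := (\int[mu]_(s in `[a, t]) Re (G s))%R.
pose V t := (\int[mu]_(s in `[a, t]) Im (G s))%R.
have Ua : U a = 0 by rewrite /U set_itv1 Rintegral_set1.
have Va : V a = 0 by rewrite /V set_itv1 Rintegral_set1.
have cont W f : W = (fun t => (\int[mu]_(s in `[a, t]) f s)%R) ->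
    mu.-integrable `[a, b] (EFin \o f) ->
    forall t, a <= t <= b -> W s @[s --> within `[a, b] (nbhs t)] --> W t.
  move=> -> fi t tab.
  have /subspace_continuousP := @parameterized_integral_continuous R a b f (ltW ab) fi.
  by apply; rewrite /= in_itv.
have Uc := cont U _ erefl Gi.1; have Vc := cont V _ erefl Gi.2.
have Ud t (tab : a < t < b) : is_derive t (1 : R) U (Re (G t)).
  apply: (integral_is_derive tab Gi.1); apply: (within_segment_continuous tab).
  by apply: (Gc t _).1; case/andP: tab => /ltW -> /ltW ->.
have Vd t (tab : a < t < b) : is_derive t (1 : R) V (Im (G t)).
  apply: (integral_is_derive tab Gi.2); apply: (within_segment_continuous tab).
  by apply: (Gc t _).2; case/andP: tab => /ltW -> /ltW ->.
have FG t : a < t < b -> D t = F t * G t.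
  move=> /andP[/ltW at_ /ltW tb]; rewrite GE mulrCA divff ?mulr1// F0//.
  exact/andP.
(* [A] and [B] are the real and imaginary parts of F(t) exp(-(U + iV)), whose derivative is zero
   because D = F G. *)
pose A t := expR (- U t) * (Re (F t) * cos (V t) + Im (F t) * sin (V t)).
pose B t := expR (- U t) * (Im (F t) * cos (V t) - Re (F t) * sin (V t)).
have eU t (tab : a < t < b) : is_derive t (1 : R) (fun s => expR (- U s))
    (- Re (G t) * expR (- U t)).
  rewrite mulrC; apply: (@is_derive1_comp _ expR (fun s => - U s)).
  exact: is_deriveN (Ud t tab).
have cV t (tab : a < t < b) : is_derive t (1 : R) (fun s => cos (V s))
    (- sin (V t) * Im (G t)) by apply: is_derive1_comp; exact: Vd.
have sV t (tab : a < t < b) : is_derive t (1 : R) (fun s => sin (V s))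
    (cos (V t) * Im (G t)) by apply: is_derive1_comp; exact: Vd.
have eUc t : a <= t <= b ->
    expR (- U s) @[s --> within `[a, b] (nbhs t)] --> expR (- U t).
  move=> /Uc Ut; apply: (cvg_comp _ _ (cvgN Ut)); exact: continuous_expR.
have cVc t : a <= t <= b ->
    cos (V s) @[s --> within `[a, b] (nbhs t)] --> cos (V t).
  by move=> /Vc Vt; apply: (cvg_comp _ _ Vt); exact: continuous_cos.
have sVc t : a <= t <= b ->
    sin (V s) @[s --> within `[a, b] (nbhs t)] --> sin (V t).
  by move=> /Vc Vt; apply: (cvg_comp _ _ Vt); exact: continuous_sin.
have AE : A b = A a.
  apply: zero_derivative_eq => // t tab.
    have [Fr Fi] := Fc t tab.
    by apply: cvgM; [exact: eUc|apply: cvgD; apply: cvgM => //;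
      [exact: cVc|exact: sVc]].
  have [Fr Fi] := Fd t tab.
  have := is_deriveM (eU t tab) (is_deriveD (is_deriveM Fr (cV t tab))
    (is_deriveM Fi (sV t tab))).
  move=> /is_derive_eq; apply.
  rewrite (FG t tab) complex_ReM complex_ImM !fctE /GRing.scale/=; ring.
have BE : B b = B a.
  apply: zero_derivative_eq => // t tab.
    have [Fr Fi] := Fc t tab.
    by apply: cvgM; [exact: eUc|apply: cvgB; apply: cvgM => //;
      [exact: cVc|exact: sVc]].
  have [Fr Fi] := Fd t tab.
  have := is_deriveM (eU t tab) (is_deriveB (is_deriveM Fi (cV t tab))
    (is_deriveM Fr (sV t tab))).
  move=> /is_derive_eq; apply.
  rewrite (FG t tab) complex_ReM complex_ImM !fctE /GRing.scale/=; ring.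
move: AE BE; rewrite /A /B Ua Va oppr0 expR0 cos0 sin0 !mulr0 subr0 addr0 !mulr1 !mul1r.
move=> AE BE; rewrite /cexp /cintegral /= -/(U b) -/(V b).
(* Multiplying back by exp(U + iV) recovers [F b]; the two factors equal to 1 are inserted so that
   what remains is a polynomial identity. *)
have eUb : expR (U b) * expR (- U b) = 1 by rewrite -expRD subrr expR0.
have cs := cos2Dsin2 (V b).
apply: complex_inj; rewrite ?complex_ReM ?complex_ImM/= -AE -BE.
  transitivity (expR (U b) * expR (- U b) * (cos (V b) ^+ 2 + sin (V b) ^+ 2) * Re (F b)).
    by rewrite eUb cs !mul1r.
  ring.
transitivity (expR (U b) * expR (- U b) * (cos (V b) ^+ 2 + sin (V b) ^+ 2) * Im (F b)).
  by rewrite eUb cs !mul1r.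
ring.
Qed.

Lemma cexp_dlog_segment F a b : a < b ->
  (forall t, a <= t <= b -> F t != 0) ->
  (forall t, a <= t <= b -> cC1_within `[a, b] F t) ->
  integrable_parts `[a, b] (fun t => cderive F t / F t) /\
  F b = F a * cexp (cintegral a b (fun t => cderive F t / F t)).
Proof.
move=> ab F0 /(cC1_within_derivative ab)[D [Fc Dc Fd]].
have [[Gr Gi] FE] := cexp_integral_segment ab F0 Fc Dc Fd.
have DE : {in `]a, b[, forall t, cderive F t / F t = D t / F t}.
  move=> t; rewrite in_itv/= => /Fd[Fr Fi]; congr (_ / _).
  by rewrite /cderive !derive1E !derive_val; case: (D t).
have DEr : {in `]a, b[, (fun t => Re (cderive F t / F t)) =1 (fun t => Re (D t / F t))}.
  by move=> t /DE ->.
have DEi : {in `]a, b[, (fun t => Im (cderive F t / F t)) =1 (fun t => Im (D t / F t))}.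
  by move=> t /DE ->.
split.
  split; [exact: integrable_segment_eq DEr Gr|exact: integrable_segment_eq DEi Gi].
rewrite FE; congr (_ * cexp _); apply: complex_inj; symmetry => /=.
  exact: Rintegral_segment_eq DEr Gr.
exact: Rintegral_segment_eq DEi Gi.
Qed.

End LogarithmicIntegral.

(** * The same formula for piecewise $C^1$ functions *)

Section PiecewiseC1.
Context {R : realType}.
Set Implicit Arguments.
Unset Strict Implicit.
Implicit Types (f : R -> R) (F G : R -> R[i]) (a b c t : R) (z w : R[i]).
Local Notation Re := complex.Re.
Local Notation Im := complex.Im.
Local Notation mu := (@lebesgue_measure R).

Lemma cexp0 : cexp 0 = 1 :> R[i].
Proof. by apply: complex_inj => /=; rewrite expR0 ?cos0 ?sin0 mul1r. Qed.

Lemma cexpD z w : cexp (z + w) = cexp z * cexp w.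
Proof.
case: z w => [a b] [c d]; apply: complex_inj => /=; rewrite expRD ?cosD ?sinD; ring.
Qed.

Lemma cexp_neq0 z : cexp z != 0.
Proof.
apply/eqP => z0; have := cexpD z (- z); rewrite z0 mul0r subrr cexp0 => /eqP.
by rewrite oner_eq0.
Qed.

Lemma integrable_segment_cat f a b c : a <= b -> b <= c ->
  mu.-integrable `[a, b] (EFin \o f) -> mu.-integrable `[b, c] (EFin \o f) ->
  mu.-integrable `[a, c] (EFin \o f).
Proof.
move=> ab bc /integrableP[mf fi] /integrableP[mg gi].
have abc : `[a, c]%classic = `[a, b] `|` `]b, c] :> set R.
  by rewrite -itv_bndbnd_setU// bnd_simp.
have mbc : measurable_fun `]b, c] (EFin \o f).
  by apply: measurable_funS mg => //; exact: subset_itv_oc_cc.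
have mac : measurable_fun `[a, c] (EFin \o f).
  by rewrite abc; apply/measurable_funU.
apply/integrableP; split => //.
have disj : [disjoint `[a, b] & `]b, c]].
  apply/disj_set2P; rewrite -subset0 => z/=; rewrite !in_itv/= => -[/andP[_ zb]].
  by rewrite ltNge zb.
rewrite abc ge0_integral_setU//; last first.
  by rewrite -abc; exact: measurableT_comp.
apply: lte_add_pinfty => //; apply: le_lt_trans gi.
by apply: ge0_subset_integral => //; [exact: measurableT_comp|exact: subset_itv_oc_cc].
Qed.

Lemma Rintegral_segment_cat f a b c : a <= b -> b <= c ->
  mu.-integrable `[a, c] (EFin \o f) ->
  (\int[mu]_(t in `[a, c]) f t = \int[mu]_(t in `[a, b]) f t + \int[mu]_(t in `[b, c]) f t)%R.
Proof.
move=> ab bc fi; rewrite -(Rintegral_itv_obnd_cbnd (r := b)).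
  by rewrite -(Rintegral_itvB (x := b) fi) ?bnd_simp// addrC subrK.
by apply: integrableS fi => //; apply: subset_itvr; rewrite bnd_simp.
Qed.

Lemma integrable_parts_cat F a b c : a <= b -> b <= c ->
  integrable_parts `[a, b] F -> integrable_parts `[b, c] F ->
  integrable_parts `[a, c] F.
Proof. by move=> ab bc [? ?] [? ?]; split; exact: (integrable_segment_cat ab bc). Qed.

Lemma cintegral_cat F a b c : a <= b -> b <= c -> integrable_parts `[a, c] F ->
  cintegral a c F = cintegral a b F + cintegral b c F.
Proof.
move=> ab bc [Fr Fi].
by apply: complex_inj; rewrite /= (Rintegral_segment_cat ab bc).
Qed.

(** Integrals add and exponentials multiply across the break points, where [F] may have corners.
    There are [n.+1] pieces, so the whole segment is not degenerate. *)
Lemma cexp_dlog_piecewise F (tau : nat -> R) n :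
  (forall k, (k < n.+1)%N -> tau k < tau k.+1) ->
  (forall t, tau 0%N <= t <= tau n.+1 -> F t != 0) ->
  (forall k, (k < n.+1)%N -> forall t, tau k <= t <= tau k.+1 ->
     cC1_within `[tau k, tau k.+1] F t) ->
  tau 0%N < tau n.+1 /\
  integrable_parts `[tau 0%N, tau n.+1] (fun t => cderive F t / F t) /\
  F (tau n.+1) =
    F (tau 0%N) * cexp (cintegral (tau 0%N) (tau n.+1) (fun t => cderive F t / F t)).
Proof.
elim: n => [|n ihn] taulr F0 FC1.
  by split; [exact: taulr|apply: cexp_dlog_segment => //; [exact: taulr|exact: FC1]].
have tlast := taulr n.+1 (ltnSn _).
have [||| tn [Fi FE]] := ihn.
- by move=> k kn; apply: taulr; exact: ltnW.
- by move=> t /andP[t0 tn]; apply: F0; rewrite t0/= (le_trans tn (ltW tlast)).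
- by move=> k kn; apply: FC1; exact: ltnW.
have [||Gi GE] := cexp_dlog_segment (F := F) tlast.
- by move=> t /andP[t0 ?]; apply: F0; rewrite (le_trans (ltW tn) t0).
- exact: FC1.
have ac := integrable_parts_cat (ltW tn) (ltW tlast) Fi Gi.
split; first exact: lt_trans tlast.
split=> //; rewrite (cintegral_cat (ltW tn) (ltW tlast))// GE FE cexpD mulrA//.
Qed.

End PiecewiseC1.

(** * Convergence of a continuous logarithm *)

Section ComplexLogarithm.
Context {R : realType}.
Set Implicit Arguments.
Unset Strict Implicit.
Implicit Types (th : R -> R) (L : R -> R[i]) (a b t al be : R) (w : R[i]).
Local Notation Re := complex.Re.
Local Notation Im := complex.Im.

(** By the intermediate value theorem, an angle leaving this interval would pass through pi/2 or
    -pi/2, where the cosine vanishes. *)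
Lemma angle_small_variation th a b :
  {within `[a, b], continuous th} -> a <= b -> th a = 0 ->
  (forall t, a <= t <= b -> 0 < cos (th t)) -> - (pi / 2) < th b < pi / 2.
Proof.
move=> thc ab tha cosp.
have no v : Num.min (th a) (th b) <= v <= Num.max (th a) (th b) -> 0 < cos v.
  by move=> /(IVT ab thc)[t]; rewrite in_itv/= => tab <-; exact: cosp.
have pi2 : 0 < pi / 2 :> R by rewrite divr_gt0// pi_gt0.
apply/andP; split; rewrite ltNge; apply/negP => thb.
  have := no (- (pi / 2)); rewrite cosN cos_pihalf ltxx tha => H.
  by suff : false by []; apply: H; rewrite ge_min thb orbT le_max; rewrite oppr_le0 ltW.
have := no (pi / 2); rewrite cos_pihalf ltxx tha => H.
by suff : false by []; apply: H; rewrite ge_min le_max thb orbT ltW.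
Qed.

(** Cosine and sine fix [th] only modulo 2 pi. From some [t0] on, continuity keeps [th t - th t0]
    strictly between -pi/2 and pi/2, where it is the arctangent of its tangent, and that expression
    converges. *)
Lemma cvg_angle th a b al be : a < b ->
  (forall T, a < T < b -> {within `[a, T], continuous th}) ->
  cos (th t) @[t --> b^'-] --> al -> sin (th t) @[t --> b^'-] --> be ->
  exists l : R, th t @[t --> b^'-] --> l.
Proof.
move=> ab thc thal thbe.
(* With 1/4, the cosines at two such times differ by less than 1/2, and so do the sines. The cosine
   of the difference of the angles is 1 minus half the sum of the squares of these differences,
   hence exceeds 3/4. *)
have close : \forall t \near b^'-, `|cos (th t) - al| < 4^-1 /\ `|sin (th t) - be| < 4^-1.
  have p4 : 0 < 4^-1 :> R by [].
  by near=> t; split; near: t; [exact: cvgr_distC_lt thal _ p4|exact: cvgr_distC_lt thbe _ p4].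
have [t0 [/andP[at0 t0b] t0P]] : exists t0, a < t0 < b /\ forall t, t0 <= t < b ->
    `|cos (th t) - al| < 4^-1 /\ `|sin (th t) - be| < 4^-1.
  have [e /= e0 eP] := close.
  pose t0 := Num.max ((a + b) / 2) (b - e / 2).
  have e20 : 0 < e / 2 by rewrite divr_gt0.
  exists t0; split=> [|t /andP[t0t tb]].
    by rewrite /t0 lt_max gt_max midf_lt//= midf_lt//= gtrBl e20.
  apply: eP => //; rewrite /ball_/= gtr0_norm ?subr_gt0//.
  have : b - e / 2 <= t by apply: le_trans t0t; rewrite /t0 le_max lexx orbT.
  by lra.
pose d t := th t - th t0.
have cosd t : t0 <= t < b -> 0 < cos (d t).
  move=> /t0P[c1 s1]; have [|c0 s0] := t0P t0; first by rewrite lexx.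
  have [e1 e0] := (cos2Dsin2 (th t), cos2Dsin2 (th t0)).
  rewrite cosB; move: c1 s1 c0 s0 e1 e0.
  rewrite !ltr_norml; nra.
have dP t : t0 <= t < b -> d t = atan (sin (d t) / cos (d t)).
  move=> /andP[t0t tb]; rewrite -[_ / _]/(tan _) tanK// in_itv/=.
  apply: (@angle_small_variation d t0 t) => //.
  - have dc : {within `[t0, t], continuous th}.
      apply: (@continuous_subspaceW _ _ _ `[a, t]); last first.
        by apply: thc; rewrite tb andbT (lt_le_trans at0).
      by apply: subset_itvr; rewrite bnd_simp ltW.
    apply/subspace_continuousP => x xt; apply: cvgB; last exact: cvg_cst.
    by move/subspace_continuousP : dc; exact.
  - by rewrite /d subrr.
  - by move=> s /andP[t0s st]; apply: cosd; rewrite t0s (le_lt_trans st).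
pose c0 := cos (th t0); pose s0 := sin (th t0).
have cosdl : cos (d t) @[t --> b^'-] --> al * c0 + be * s0.
  under eq_fun do rewrite /d cosB.
  by apply: cvgD; apply: cvgM => //; exact: cvg_cst.
have sindl : sin (d t) @[t --> b^'-] --> be * c0 - al * s0.
  under eq_fun do rewrite /d sinB.
  by apply: cvgB; apply: cvgM => //; exact: cvg_cst.
(* A limit of positive numbers could be 0. Here it is the scalar product of (al, be) with the unit
   vector (c0, s0), and these differ by less than 1/4 in each coordinate. *)
have cosl0 : al * c0 + be * s0 != 0.
  have [|c1 s1] := t0P t0; first by rewrite lexx.
  have e0 := cos2Dsin2 (th t0).
  suff : 0 < al * c0 + be * s0 by move=> /lt0r_neq0.
  by move: c1 s1 e0; rewrite /c0 /s0 !ltr_norml; nra.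
exists (atan ((be * c0 - al * s0) / (al * c0 + be * s0)) + th t0).
have tan_cvg : atan (sin (d t) / cos (d t)) @[t --> b^'-] -->
    atan ((be * c0 - al * s0) / (al * c0 + be * s0)).
  by apply: continuous_cvg; [exact: continuous_atan|apply: cvgM => //; exact: cvgV].
have : atan (sin (d t) / cos (d t)) + th t0 @[t --> b^'-] -->
    atan ((be * c0 - al * s0) / (al * c0 + be * s0)) + th t0.
  by apply: cvgD => //; exact: cvg_cst.
apply: cvg_trans; apply: near_eq_cvg; near=> t; rewrite -dP ?subrK//.
by apply/andP; split; near: t; [exact: nbhs_left_ge|exact: nbhs_left_lt].
Unshelve. all: by end_near. Qed.

(** The modulus determines the real part. Once the modulus is divided out, the cosine and sine of
    the imaginary part converge, and [cvg_angle] applies. *)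
Lemma cvg_complex_log L a b w : a < b ->
  (forall T, a < T < b -> {within `[a, T], continuous (fun t => Im (L t))}) ->
  w != 0 -> cvg_parts b^'- (fun t => cexp (L t)) w ->
  exists l, cvg_parts b^'- L l /\ cexp l = w.
Proof.
move=> ab Lc /sqr_norm_neq0 w0 [Lr Li].
(* [N] is the square of the modulus, hence the factor 2 in [NL] and the limit [ln (N w) / 2]. *)
pose N z : R := Re z ^+ 2 + Im z ^+ 2.
have Nw0 : 0 < N w by rewrite lt0r w0 addr_ge0// sqr_ge0.
have NL t : N (cexp (L t)) = expR (Re (L t) * 2).
  rewrite /N /= !exprMn -mulrDr cos2Dsin2 mulr1 -expRM_natr//.
have Nl : N (cexp (L t)) @[t --> b^'-] --> N w.
  by apply: cvgD; rewrite expr2; under eq_fun do rewrite expr2; exact: cvgM.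
have Rel : Re (L t) @[t --> b^'-] --> ln (N w) / 2.
  rewrite (_ : (fun t => Re (L t)) = fun t => ln (N (cexp (L t))) / 2); last first.
    by apply/funext => t; rewrite NL expRK mulfK.
  apply: cvgM; last exact: cvg_cst.
  by apply: continuous_cvg => //; exact: continuous_ln.
have expl : expR (- Re (L t)) @[t --> b^'-] --> expR (- (ln (N w) / 2)).
  by apply: continuous_cvg; [exact: continuous_expR|exact: cvgN].
have expK t : expR (- Re (L t)) * expR (Re (L t)) = 1.
  by rewrite -expRD addNr expR0.
have cosl : cos (Im (L t)) @[t --> b^'-] --> expR (- (ln (N w) / 2)) * Re w.
  rewrite (_ : (fun t => cos _) = fun t => expR (- Re (L t)) * Re (cexp (L t))).
    exact: cvgM.
  by apply/funext => t /=; rewrite mulrA expK mul1r.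
have sinl : sin (Im (L t)) @[t --> b^'-] --> expR (- (ln (N w) / 2)) * Im w.
  rewrite (_ : (fun t => sin _) = fun t => expR (- Re (L t)) * Im (cexp (L t))).
    exact: cvgM.
  by apply/funext => t /=; rewrite mulrA expK mul1r.
have [i Iml] := cvg_angle ab Lc cosl sinl.
exists (ln (N w) / 2 +i* i); split=> //; apply: complex_inj.
  apply: cvg_unique Lr; first exact: Rhausdorff.
  apply: cvgM.
    by apply: continuous_cvg => //; exact: continuous_expR.
  by apply: continuous_cvg => //; exact: continuous_cos.
apply: cvg_unique Li; first exact: Rhausdorff.
apply: cvgM.
  by apply: continuous_cvg => //; exact: continuous_expR.
by apply: continuous_cvg => //; exact: continuous_sin.
Qed.

End ComplexLogarithm.

(** * Values of a rational function along a path, and the limit of its logarithmic integral *)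

Section RestrictionToPaths.
Context {R : realType} {N : nat}.
Set Implicit Arguments.
Unset Strict Implicit.
Variables (X Z : set (hvec R N)) (f : rfun R N).
Hypotheses (Xirr : zirreducible X) (Zirr : zirreducible Z) (ZX : Z `<=` X).
Hypothesis rf : ratfun X f.
Implicit Types (h : rfun R N) (v w : hvec R N) (A : set R) (t : R).

(** The representative that is regular at [v] computes the value wherever its denominator is
    non-zero, so regularity near [v] reduces to that of one quotient of polynomials. *)
Lemma is_rvalue_ratio v z : is_rvalue X Z f v z -> exists h, [/\ ratfun Z h,
  peval h.2 v != 0, z = peval h.1 v / peval h.2 v &
  forall w, Z w -> peval h.2 w != 0 ->
    rvalue X Z f w = peval h.1 w / peval h.2 w].
Proof.
move=> [k [h [[rk kf nk] [rh kh nh ->]]]]; exists h; split=> // w Zw hw.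
by apply: rvalueE => //; exists k, h.
Qed.

Lemma chart_neq0 h i v : ratfun Z h -> v 0 i != 0 ->
  (peval h.2 (chart i v) != 0) = (peval h.2 v != 0).
Proof.
move=> [[d [_ h2]] _] vi; rewrite /chart (@peval_scale _ _ d)//.
by rewrite mulf_eq0 expf_eq0 invr_eq0 (negbTE vi) andbF.
Qed.

(** The vectors of a path may be rescaled arbitrarily from one time to the next; only their chart
    coordinates are regular. Numerator and denominator have the same degree, so the quotient does
    not see the rescaling. *)
Lemma rvalue_chart h i v : ratfun Z h -> Z v -> v 0 i != 0 ->
  (forall w, Z w -> peval h.2 w != 0 ->
     rvalue X Z f w = peval h.1 w / peval h.2 w) ->
  peval h.2 (chart i v) != 0 ->
  rvalue X Z f v = peval h.1 (chart i v) / peval h.2 (chart i v).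
Proof.
move=> rh Zv vi rhE; rewrite (chart_neq0 rh vi) => hv.
by rewrite rhE// (ratio_scale _ rh)// invr_eq0.
Qed.

Lemma rvalue_continuous A (c : R -> hvec R N) t z :
  (forall s, A s -> Z (c s)) -> A t -> pcontinuous A c ->
  is_rvalue X Z f (c t) z ->
  cvg_parts (within A (nbhs t)) (fun s => rvalue X Z f (c s)) z.
Proof.
move=> AZ At cc /is_rvalue_ratio[h [rh ht -> rhE]].
have [i cti cl] := cc t At.
pose u s := chart i (c s).
have Pu G : cvg_parts (within A (nbhs t)) (fun s => peval G (u s)) (peval G (u t)).
  apply: (@peval_closed _ _ _ (fun a => cvg_parts (within A (nbhs t)) a (a t))).
  - by move=> a; exact: cvg_parts_cst.
  - by move=> a b; exact: cvg_partsD.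
  - by move=> a b; exact: cvg_partsM.
  - by move=> l; apply/cvg_partsP; exact: cl.
have hut : peval h.2 (u t) != 0 by rewrite (chart_neq0 rh cti).
have ci0 : \forall s \near within A (nbhs t), u s 0 i != 0.
  apply: (@cvg_parts_neq0 _ _ _ _ _ (u t 0 i)); last by apply/cvg_partsP; exact: cl.
  by rewrite mxE mulVf ?oner_neq0.
rewrite -(ratio_scale _ rh (a := (c t 0 i)^-1)) ?invr_eq0//.
apply: near_eq_cvg_parts (cvg_partsM _ (Pu h.1) (cvg_partsV _ hut (Pu h.2))).
near=> s; symmetry; apply: (rvalue_chart (i := i) rh _ _ rhE).
- by apply: AZ; near: s; exact: withinT.
- have : u s 0 i != 0 by near: s.
  by rewrite mxE; apply: contraNN => /eqP ->; rewrite mulr0.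
- by near: s; exact: cvg_parts_neq0 hut (Pu h.2).
Unshelve. all: by end_near. Qed.

Lemma rvalue_cC1_within A (c : R -> hvec R N) t z :
  (forall s, A s -> Z (c s)) -> A t -> pC1 A c ->
  is_rvalue X Z f (c t) z -> cC1_within A (fun s => rvalue X Z f (c s)) t.
Proof.
move=> AZ At cC1 /is_rvalue_ratio[h [rh ht _ rhE]].
have [i [k [kC1 ck]]] := cC1 t At.
(* [u] extends the chart coordinates to both sides of [t]. Off [A] it need not lie on [Z], so the
   comparison with the value of [f] is made within [A] only. *)
pose u s : hvec R N := \row_l k l s.
have Pu G : cC1_at (fun s => peval G (u s)) t.
  apply: (@peval_closed _ _ _ (fun a => cC1_at a t)).
  - by move=> a; exact: cC1_at_cst.
  - by move=> a b; exact: cC1_atD.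
  - by move=> a b; exact: cC1_atM.
  - move=> l; rewrite (_ : (fun s => u s 0 l) = k l); last first.
      by apply/funext => s; rewrite mxE.
    by split; apply: C1_C1_at; [exact: (kC1 l).1|exact: (kC1 l).2].
have chartE s : (forall l, chart i (c s) 0 l = k l s) -> chart i (c s) = u s.
  by move=> ckE; apply/rowP => l; rewrite ckE mxE.
have [cti /chartE cut] := nbhs_singleton ck At.
have hut : peval h.2 (u t) != 0 by rewrite -cut (chart_neq0 rh cti).
exists (fun s => peval h.1 (u s) / peval h.2 (u s)).
  by apply: cC1_atM => //; exact: cC1_atV.
have hus : \forall s \near within A (nbhs t), peval h.2 (u s) != 0.
  by apply: cvg_within; exact: cvg_parts_neq0 hut (cC1_at_continuous (Pu h.2)).
near=> s.
have [ci /chartE cus] : c s 0 i != 0 /\ forall l, chart i (c s) 0 l = k l s.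
  by near: s.
rewrite -cus; apply: (rvalue_chart rh _ ci rhE).
  by apply: AZ; near: s; exact: withinT.
by rewrite cus; near: s.
Unshelve. all: by end_near. Qed.

Lemma dlog_int_exp (U : set (hvec R N)) Q P (gam : R -> hvec R N) (T : R) :
  U `<=` Z -> limit_path U Q P gam ->
  (forall t, 0 <= t < 1 -> no_zero_pole X Z f (gam t)) -> 0 < T < 1 ->
  integrable_parts `[0, T] (fun t =>
    cderive (fun s => rvalue X Z f (gam s)) t / rvalue X Z f (gam t)) /\
  rvalue X Z f (gam T) =
    rvalue X Z f (gam 0) * cexp (dlog_int X Z f gam 0 T).
Proof.
move=> UZ [_ gamU _ _ gamC1] fgam /andP[T0 T1].
(* A subdivision without pieces would give T = 0; the number of pieces is therefore [n.+1]. *)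
have [|[|n] [tau [tau0 tauT taulr tauC1]]] := gamC1 T.
- exact/andP.
- by move: T0; rewrite -tauT tau0 ltxx.
have tau_le j k : (j <= k)%N -> (k <= n.+1)%N -> tau j <= tau k.
  elim: k => [|k ihk]; first by rewrite leqn0 => /eqP ->.
  rewrite leq_eqVlt => /predU1P[->//|jk kn].
  by rewrite (le_trans (ihk _ (ltnW kn)))// ltW// taulr.
have gamZ t : 0 <= t < 1 -> Z (gam t) by move=> /gamU/UZ.
have t1 t : tau 0%N <= t <= tau n.+1 -> 0 <= t < 1.
  by rewrite tau0 tauT => /andP[-> /le_lt_trans]; exact.
have [] := @cexp_dlog_piecewise R (fun s => rvalue X Z f (gam s)) tau n taulr.
- move=> t /t1 t01; have [z z0 fz] := fgam t t01.
  by rewrite (rvalueE _ _ _ _ _ fz)//; exact: gamZ.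
- move=> k kn t tk.
  have k1 s : `[tau k, tau k.+1]%classic s -> 0 <= s < 1.
    rewrite /= in_itv/= => /andP[ks sk]; apply: t1.
    by rewrite (le_trans (tau_le _ _ (leq0n k) (ltnW kn)))// (le_trans sk)// tau_le.
  have ttk : `[tau k, tau k.+1]%classic t by rewrite /= in_itv.
  have [z _ fz] := fgam t (k1 t ttk).
  apply: (rvalue_cC1_within _ ttk _ fz); last exact: tauC1.
  by move=> s /k1/gamZ.
by rewrite tau0 tauT.
Qed.

Lemma cvg_onem_left : (1 - e : R) @[e --> 0^'+] --> 1^'-.
Proof.
move=> B [d /= d0 dB]; exists d => //= e; rewrite /ball_/= sub0r normrN => ed e0.
by apply: dB; rewrite /ball_/= ?subKr// gtrBl.
Qed.

Lemma cexp_dlog_lim (U : set (hvec R N)) Q P (gam : R -> hvec R N) zP zQ :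
  U `<=` Z -> limit_path U Q P gam -> Z (gam 1) ->
  (forall t, 0 <= t < 1 -> no_zero_pole X Z f (gam t)) ->
  zP != 0 -> is_rvalue X Z f P zP -> zQ != 0 -> is_rvalue X Z f Q zQ ->
  cexp (dlog_lim X Z f gam) = zP / zQ.
Proof.
move=> UZ gamP Zgam1 fgam zP0 fP zQ0 fQ.
have [gamc gamU Qgam0 Pgam1 _] := gamP.
pose F t := rvalue X Z f (gam t); pose L t := dlog_int X Z f gam 0 t.
have gamZ (t : R) : unit_itv t -> Z (gam t).
  rewrite /unit_itv/= in_itv/= => /andP[t0].
  rewrite le_eqVlt => /predU1P[->//|t1]; apply/UZ/gamU; exact/andP.
have F0 : F 0 = zQ.
  apply: rvalueE => //; last exact: is_rvalue_same_pt fQ.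
  by apply: gamZ; rewrite /unit_itv/= in_itv/= lexx ler01.
have Lexp := dlog_int_exp UZ gamP fgam.
have unit1 : unit_itv (1 : R) by rewrite /unit_itv/= in_itv/= lexx ler01.
(* At time 1 only the continuity of the path and the regularity of [f] at [P] are used; no
   derivative exists there in general. *)
have F1 : cvg_parts 1^'- F zP.
  have [Fr Fi] := rvalue_continuous gamZ unit1 gamc (is_rvalue_same_pt Pgam1 fP).
  have left1 : 1^'- `=>` within (@unit_itv R) (nbhs (1 : R)).
    move=> B [d /= d0 dB]; near=> t; apply: dB.
      rewrite /ball_/=; near: t; exists d => //.
    rewrite /unit_itv/= in_itv/=; apply/andP; split; near: t.
      exact: nbhs_left_ge.
    exact: nbhs_left_le.
  by split; [apply: cvg_trans Fr|apply: cvg_trans Fi]; exact: cvg_app.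
have LF : cvg_parts 1^'- (fun t => cexp (L t)) (zP / zQ).
  apply: (@near_eq_cvg_parts _ _ _ _ (fun t => F t / zQ)).
    near=> t; have [|_ FE] := Lexp t.
      by apply/andP; split; near: t; [exact: nbhs_left_gt|exact: nbhs_left_lt].
    by rewrite [F t]FE -/(F 0) F0 mulrAC divff// mul1r.
  by apply: cvg_partsM => //; exact: cvg_parts_cst.
have Lc T : 0 < T < 1 -> {within `[0, T], continuous (fun t => complex.Im (L t))}.
  move=> T01; have [[_ Li] _] := Lexp T T01; case/andP: T01 => /ltW T0 _.
  exact: parameterized_integral_continuous T0 Li.
have [|l [[Lr Li] lE]] := cvg_complex_log (ltr01 : (0 : R) < 1) Lc _ LF.
  by rewrite mulf_neq0// invr_eq0.
have Llim : (dlog_int X Z f gam 0 (1 - eps) : R[i]^o) @[eps --> 0^'+] --> (l : R[i]^o).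
  apply/cvg_partsP; split.
    exact: (cvg_comp _ _ cvg_onem_left Lr).
  exact: (cvg_comp _ _ cvg_onem_left Li).
rewrite -lE; congr cexp.
exact: (@cvg_lim R[i]^o (@norm_hausdorff R[i] R[i]^o) _ _ _ _ _ Llim).
Unshelve. all: by end_near. Qed.

End RestrictionToPaths.

(** * Exponentiating the logarithm of the Parshin symbol *)

Section ParshinLogarithm.
Context {R : realType}.
Set Implicit Arguments.
Unset Strict Implicit.
Implicit Types (z : R[i]).

Lemma cexpMz z (n : int) : cexp (z * n%:~R) = cexp z ^ n.
Proof.
have expn k : cexp (z * k%:R) = cexp z ^+ k.
  elim: k => [|k ihk]; first by rewrite mulr0 cexp0.
  by rewrite -natr1 mulrDr mulr1 cexpD ihk exprSr.
case: n => [k|k]; first exact: expn.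
rewrite NegzE mulrNz mulrN -exprnN; apply: (mulfI (cexp_neq0 (z * k.+1%:~R))).
by rewrite -cexpD subrr cexp0 -[k.+1%:~R]/(k.+1%:R) expn divff// -expn cexp_neq0.
Qed.

Lemma cexp_pi_i : cexp (pi_i R) = -1.
Proof.
by rewrite /cexp /= expR0 cospi sinpi !mul1r; apply: complex_inj => /=; rewrite ?oppr0.
Qed.

Lemma pi_i_neq0 : pi_i R != 0.
Proof. by rewrite /pi_i eq_complex /= eqxx/= gt_eqF// pi_gt0. Qed.

(** Each integral occurs twice in the cyclic sum, with coefficient $m_b n_c$ where k = a and $-m_b
    n_a$ where k = c; the two add up to $D_k$. The remaining terms give K exactly, not only modulo
    2. *)
Lemma log_parshinE (N : nat) (X Z : set (hvec R N)) (gam : R -> hvec R N)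
    (m n : 'I_3 -> int) (g : 'I_3 -> rfun R N) :
  (2 * pi_i R) ^- 2 * log_parshin X Z gam m n g =
  pi_i R * (parshin_K m n)%:~R +
  \sum_(k < 3) dlog_lim X Z (g k) gam * (parshin_D m n k)%:~R.
Proof.
have two_pi_i : (2 * pi_i R) ^+ 2 != 0.
  by rewrite expf_neq0// mulf_neq0// ?pnatr_eq0// pi_i_neq0.
have [i1 i2] : lift ord0 (lift ord0 ord0) = 2 :> 'I_3 /\ lift ord0 ord0 = 1 :> 'I_3.
  by split; apply/val_inj.
have D0 : parshin_D m n 0 = m 1 * n 2 - m 2 * n 1.
  by rewrite /parshin_D; congr (m _ * n _ - m _ * n _); apply/val_inj.
have D1 : parshin_D m n 1 = m 2 * n 0 - m 0 * n 2.
  by rewrite /parshin_D; congr (m _ * n _ - m _ * n _); apply/val_inj.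
have D2 : parshin_D m n 2 = m 0 * n 1 - m 1 * n 0.
  by rewrite /parshin_D; congr (m _ * n _ - m _ * n _); apply/val_inj.
rewrite /log_parshin /log_parshin1 -!mulrDr (mulKf two_pi_i).
rewrite !big_ord_recl big_ord0 addr0 i1 i2 D0 D1 D2 /parshin_K.
move: (dlog_lim _ _ (g 0) _) (dlog_lim _ _ (g 1) _) (dlog_lim _ _ (g 2) _).
move: (m 0) (m 1) (m 2) (n 0) (n 1) (n 2) (pi_i R).
move=> m0 m1 m2 n0 n1 n2 p I0 I1 I2; rewrite !(rmorphD, rmorphN, rmorphM)/=; ring.
Qed.

Lemma cexp_log_parshin (N : nat) (X Z : set (hvec R N)) (gam : R -> hvec R N)
    (m n : 'I_3 -> int) (g : 'I_3 -> rfun R N) :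
  cexp ((2 * pi_i R) ^- 2 * log_parshin X Z gam m n g) =
  (-1) ^ parshin_K m n *
  \prod_(k < 3) cexp (dlog_lim X Z (g k) gam) ^ parshin_D m n k.
Proof.
rewrite log_parshinE cexpD cexpMz cexp_pi_i; congr (_ * _).
rewrite (big_morph _ (@cexpD R) (@cexp0 R)).
by apply: eq_bigr => k _; rewrite cexpMz.
Qed.

End ParshinLogarithm.

Theorem theorem0p9 (R : realType) (N : nat) (X : set (hvec R N))
  (hX : smooth_projective_surface X)
  (f : 'I_3 -> rfun R N)
  (hf : forall k, ratfun X (f k) /\ ~ vanish X (f k).1)
  (r : nat) (C : 'I_r.+1 -> set (hvec R N))
  (hCinj : injective C)
  (hC : forall Z, (exists i, C i = Z) <->
     irr_curve X Z /\ exists k n, is_ord X Z (f k) n /\ n != 0)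
  (hCns : forall i, nonsingular (C i))
  (hC3 : forall i j l v, i != j -> j != l -> i != l ->
     C i v -> C j v -> ~ C l v)
  (hCtr : forall i j v, i != j -> C i v -> C j v -> meet_transversally X (C i) (C j) v)
  (nu : 'I_3 -> 'I_r.+1 -> int)
  (hnu : forall k i, is_ord X (C i) (f k) (nu k i))
  (x : 'I_r.+1 -> rfun R N)
  (hx : forall i, ratfun X (x i))
  (hxord : forall i j, is_ord X (C j) (x i) (i == j)%:Z)
  (s : nat) (P : 'I_s -> hvec R N)
  (hPinj : forall i i', same_pt (P i) (P i') -> i = i')
  (hP : forall v, (exists i, same_pt (P i) v) <->
     C ord0 v /\ exists2 j, j != ord0 & C j v)
  (J : 'I_s -> 'I_r.+1)
  (hJ : forall i, J i != ord0 /\ C (J i) (P i))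
  (hloc : forall i, local_equation X (pt (P i)) (C ord0) (x ord0) /\
     local_equation X (pt (P i)) (C (J i)) (x (J i)))
  (g : 'I_s -> 'I_3 -> rfun R N)
  (hg : forall i k, ratfun X (g i k) /\
     req X (f k) (rmul (rmul (rpow (x ord0) (nu k ord0))
                             (rpow (x (J i)) (nu k (J i)))) (g i k)))
  (hgP : forall i k, local_unit X (pt (P i)) (g i k))
  (gen : nat) (hgen : has_genus (C ord0) gen)
  (Q : hvec R N) (hQ : punctured (C ord0) P Q)
  (gam : 'I_s -> R -> hvec R N)
  (hgam : forall i, limit_path (punctured (C ord0) P) Q (P i) (gam i))
  (hgQ : forall i k, no_zero_pole X (C ord0) (g i k) Q)
  (hggam : forall i k t, 0 <= t < 1 ->
     no_zero_pole X (C ord0) (g i k) (gam i t))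
  (sig0 : 'I_s -> R -> R -> hvec R N)
  (hsig0 : forall i, \forall eps \near 0^'+,
     simple_loop_around X (C ord0) (punctured (C ord0) P) (x (J i))
       (gam i (1 - eps)) (sig0 i eps))
  (hsig0P : forall i, shrinks_to (P i) (sig0 i))
  (al be : 'I_gen -> R -> hvec R N)
  (hal : forall j, loop_at (punctured (C ord0) P) Q (al j))
  (hbe : forall j, loop_at (punctured (C ord0) P) Q (be j))
  (halbe : handle_loops (C ord0) Q al be)
  (hrel : \forall eps \near 0^'+,
     homotopic (punctured (C ord0) P)
       (pprod Q (pcommutators al be ++
          [seq pcat (pcat (ptrunc eps (gam i)) (sig0 i eps))
                    (prevert (ptrunc eps (gam i))) | i <- enum 'I_s]))
       (fun=> Q))
  (i : 'I_s) :
  let m := nu ^~ ord0 in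
  let n := nu ^~ (J i) in
  parshin_symbol X (P i) m n (g i) =
  cexp ((2 * pi_i R) ^- 2 * log_parshin X (C ord0) (gam i) m n (g i))
  * \prod_(k < 3) rvalue X (C ord0) (g i k) Q ^ parshin_D m n k.
Proof.
move=> m n; rewrite cexp_log_parshin /parshin_symbol -mulrA; congr (_ * _).
rewrite -big_split/=; apply: eq_bigr => k _.
have [Xirr _ _] := hX; have [[Zirr ZX _] _] := (hC (C ord0)).1 (ex_intro _ ord0 erefl).
have [rg _] := hg i k.
have same_refl : same_pt (P i) (P i) by exists 1; rewrite ?oner_neq0 ?scale1r.
have [ZP _] := (hP (P i)).1 (ex_intro _ i same_refl).
(* The end point is a puncture, so [limit_path] does not place it on the curve; it lies on $C_0$ as
   a representative of $P_i$, by [hP]. *)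
have [_ _ _ Pgam1 _] := hgam i.
have [Zgam1 _] := (hP (gam i 1)).1 (ex_intro _ i Pgam1).
have ZQ : C ord0 Q by case: hQ.
have [h [h1 h2 gP]] := local_unit_ratio (hgP i k).
have [zQ zQ0 gQ] := hgQ i k.
have UZ : punctured (C ord0) P `<=` C ord0 by move=> v [].
have gP0 : peval h.1 (P i) / peval h.2 (P i) != 0 by rewrite mulf_neq0// invr_eq0.
(* The symbol takes $g_k(P_i)$ on $X$, the path approaches it on $C_0$; [gP] gives the same quotient
   for both. *)
rewrite (rvalueE Xirr Xirr _ rg _ (gP X (ZX _ ZP)))//; last exact: ZX.
rewrite (rvalueE Xirr Zirr ZX rg ZQ gQ).
rewrite (cexp_dlog_lim Xirr Zirr ZX rg UZ (hgam i) Zgam1 (hggam i k) gP0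
  (gP _ ZP) zQ0 gQ).
by rewrite -expfzMl divfK.
Qed.
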